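(* Let $(X,d)$ be a graph-like continuum with $\mathcal{H}^1(X)<\infty$. Then the intrinsic metric of $(X,d)$ is compatible with $d$ (i.e. induces the same topology), and turns $X$ into a geodesic metric space.
   Context: A continuum is a compact, connected, non-empty metrizable space. An edge of a topological space $X$ is an open subspace $I\subseteq X$ homeomorphic to $(0,1)$ whose closure in $X$ is homeomorphic to $[0,1]$. An edge-set of $X$ is a set of pairwise disjoint edges of $X$. $X$ is graph-like if it has an edge-set $E$ such that $X\setminus\bigcup E$ is totally disconnected. $\mathcal{H}^1(X)=\lim_{\delta\to0}\inf\{\sum_i \mathrm{diam}(U_i): \bigcup_i U_i=X,\ \mathrm{diam}(U_i)<\delta\}$ (countable covers), computed with respect to $d$. An arc is a space homeomorphic to $[0,1]$; its length $\ell$ in a metric space $(X,d)$ is the supremum of $\sum_i d(\sigma(s_i),\sigma(s_{i+1}))$ over finite increasing sequences $(s_i)$ in $[0,1]$ containing both endpoints, where $\sigma$ is a homeomorphism from $[0,1]$ to the arc. The intrinsic metric $\rho$ of $(X,d)$ is $\rho(x,y):=\inf\{\ell(A): A \text{ is an arc in } X \text{ with endpoints } x,y\}$ for $x\neq y$, and $\rho(x,x)=0$. A metric space $(X,\rho)$ is geodesic if for all $x,y\in X$ there is a map $\tau:[0,l]\to X$ with $\tau(0)=x$, $\tau(l)=y$ and $\rho(\tau(t),\tau(t'))=|t-t'|$ for all $t,t'\in[0,l]$. *)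

(* Defs.v *)
From HB Require Import structures.
From mathcomp Require Import all_boot all_order all_algebra.
From mathcomp Require Import all_classical all_reals all_analysis.

Set Implicit Arguments.
Unset Strict Implicit.
Unset Printing Implicit Defensive.

Import Order.TTheory GRing.Theory Num.Theory.
Import numFieldNormedType.Exports.

Local Open Scope classical_set_scope.
Local Open Scope ring_scope.

Definition homeomorphism {T U : topologicalType} (A : set T) (B : set U)
    (f : T -> U) : Prop :=
  [/\ set_bij A B f, {within A, continuous f} &
      exists2 g : U -> T, {in A, cancel f g} & {within B, continuous g}].

Definition homeomorphic {T U : topologicalType} (A : set T) (B : set U) : Prop :=
  exists f : T -> U, homeomorphism A B f.

Definition continuum (X : topologicalType) : Prop :=
  [/\ compact [set: X], connected [set: X] & [set: X] !=set0].

Section GraphLike.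
Variables (R : realType) (X : topologicalType).

Definition edge (I : set X) : Prop :=
  [/\ open I, homeomorphic `]0 : R, 1[%classic I &
      homeomorphic `[0 : R, 1]%classic (closure I)].

Definition edge_set (E : set (set X)) : Prop :=
  E `<=` edge /\ trivIset E id.

Definition graph_like : Prop :=
  exists2 E : set (set X),
    edge_set E & totally_disconnected (~` \bigcup_(I in E) I).

End GraphLike.

Section Metric.
Variables (R : realType) (X : metricType R).

(* Including 0 in the supremum only matters for [diam set0 = 0]
   (the supremum of the empty set in [\bar R] being [-oo]). *)
Definition diam (U : set X) : \bar R :=
  ereal_sup (0%E |` [set (mdist p.1 p.2)%:E | p in U `*` U]).

(* Finite covers are covered by this definition: pad them with [set0]. *)
Definition hausdorff1_content (delta : R) : \bar R :=
  ereal_inf [set (\sum_(0 <= i <oo) diam (U i))%E | U in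
    [set U : nat -> set X | \bigcup_i U i = [set: X] /\
                            forall i, (diam (U i) < delta%:E)%E]].

Definition hausdorff1 : \bar R :=
  lim (hausdorff1_content delta @[delta --> 0^'+]).

(* [itv_partition 0 1 s] says that [0 :: s] is a strictly increasing sequence
   ending at 1. *)
Definition polygonal_length (sigma : R -> X) (s : seq R) : R :=
  \sum_(0 <= i < size s)
    mdist (sigma (nth 1 (0 :: s) i)) (sigma (nth 1 (0 :: s) i.+1)).

Definition arc_length (sigma : R -> X) : \bar R :=
  ereal_sup [set (polygonal_length sigma s)%:E | s in itv_partition 0 1].

(* An arc [A] is given together with a homeomorphism [sigma] from [0, 1] onto
   it; its length depends only on [A], and an arc with endpoints [x] and [y]
   always has such a parametrization running from [x] to [y].
   The value is [+oo] if [x] and [y] are not joined by an arc of finite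
   length. *)
Definition intrinsic_edist (x y : X) : \bar R :=
  if x == y then 0%E else
  ereal_inf [set l | exists (A : set X) (sigma : R -> X),
    [/\ homeomorphism `[0 : R, 1]%classic A sigma, sigma 0 = x, sigma 1 = y &
        l = arc_length sigma]].

Definition intrinsic_dist (x y : X) : R := fine (intrinsic_edist x y).

End Metric.

Section MetricFunctions.
Variables (R : realType).

Definition is_metric (X : Type) (rho : X -> X -> R) : Prop :=
  [/\ forall x y, 0 <= rho x y,
      forall x y, rho x y = 0 <-> x = y,
      forall x y, rho x y = rho y x &
      forall x y z, rho x z <= rho x y + rho y z].

Definition induces_topology (X : topologicalType) (rho : X -> X -> R) : Prop :=
  forall U : set X, open U <->
    forall x, U x -> exists2 e : R, 0 < e & [set y | rho x y < e] `<=` U.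

Definition geodesic (X : Type) (rho : X -> X -> R) : Prop :=
  forall x y : X, exists (l : R) (tau : R -> X),
    [/\ 0 <= l, tau 0 = x, tau l = y &
        {in `[0, l] &, forall t t', rho (tau t) (tau t') = `|t - t'|}].

End MetricFunctions.

(* Main.v *)
(** Write [rho x y] for the limit, as
    [dl] tends to 0, of the infimal length of finite chains from [x] to [y] with
    steps shorter than [dl].  In a compact space an ultrafilter limit of such
    chains is a [rho]-geodesic, and a path of finite length is approximated by
    chains, so [rho] is the intrinsic metric.

    Suppose [X] has, for every [dl], an open cover by sets of diameter less than
    [dl] whose diameters sum to at most [M].  By connectedness two points are
    joined by a sequence of pairwise distinct consecutively intersecting members
    of the cover, hence by a chain of length at most [M + 1].  If [N + 1] points
    are pairwise at [rho]-distance more than [3a], then the initial parts of such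
    sequences, up to the exit from the [rho]-ball of radius [a], use disjoint
    subfamilies of the cover, each of total diameter at least [a]; hence
    [N * a <= M], and [X] is [rho]-totally bounded.  Closed [rho]-balls are closed
    for the original metric, so finitely many small ones covering [X] show that
    [rho] is continuous, i.e. compatible. *)
Require Import Defs.
From mathcomp Require Import all_boot all_order all_algebra.
From mathcomp Require Import all_classical all_reals all_analysis.
From mathcomp Require Import lra.

Set Implicit Arguments.
Unset Strict Implicit.
Unset Printing Implicit Defensive.

Import Order.TTheory GRing.Theory Num.Theory.
Import numFieldNormedType.Exports.

Local Open Scope classical_set_scope.
Local Open Scope ring_scope.

(** * Chains, limits of chains, and paths in compact spaces *)

Section Chains.
Variables (R : realType) (X : metricType R).
Implicit Types (x y z : X) (p : seq X) (dl L : R).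

Fixpoint walk_length x p : R :=
  if p is y :: p' then mdist x y + walk_length y p' else 0.

Lemma walk_length_cat x p q :
  walk_length x (p ++ q) = walk_length x p + walk_length (last x p) q.
Proof. by elim: p x => [|y p IH] x /=; rewrite ?add0r// IH addrA. Qed.

Lemma mdist_le_walk_length x p : mdist x (last x p) <= walk_length x p.
Proof.
elim: p x => [|y p IH] x /=; first by rewrite mdistxx.
by rewrite (le_trans (metric_triangle x y _))// lerD2l.
Qed.

Definition chain dl L x y := exists p,
  [/\ path (fun a b => mdist a b < dl) x p, last x p = y & walk_length x p <= L].

Lemma chain0 dl x : chain dl 0 x x.
Proof. by exists [::]. Qed.

Lemma chain1 dl x y : mdist x y < dl -> chain dl (mdist x y) x y.
Proof. by move=> xy; exists [:: y]; split => //=; rewrite ?xy// addr0. Qed.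

Lemma chain_mdist dl L x y : chain dl L x y -> mdist x y <= L.
Proof. by move=> [p [_ <-]]; apply: le_trans; exact: mdist_le_walk_length. Qed.

Lemma chain_le dl dl' L L' x y : dl <= dl' -> L <= L' ->
  chain dl L x y -> chain dl' L' x y.
Proof.
move=> dl_le L_le [p [pp lp wp]]; exists p; split => //; last exact: le_trans L_le.
by apply: sub_path pp => a b ab; exact: lt_le_trans dl_le.
Qed.

Lemma chain_trans dl L L' y x z :
  chain dl L x y -> chain dl L' y z -> chain dl (L + L') x z.
Proof.
move=> [p [pp lp wp]] [q [pq lq wq]]; exists (p ++ q).
by rewrite cat_path last_cat walk_length_cat lp pp pq lq lerD.
Qed.

Lemma chain_sym dl L x y : chain dl L x y -> chain dl L y x.
Proof.
move=> [p]; elim: p x L => [|a p IH] x L /= [].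
  by move=> _ -> L0; apply: chain_le (chain0 _ _).
move=> /andP[xa pp] lp wp.
have ay : chain dl (L - mdist x a) y a by apply: IH; split => //; lra.
apply: chain_le (chain_trans ay (@chain1 _ a x _)) => //; rewrite metric_sym//.
lra.
Qed.

(* [limit_chain L x y] expresses [rho x y <= L] for the intrinsic metric [rho];
   in a compact space it is equivalent to the existence of a path of length at
   most [L]. *)
Definition limit_chain L x y :=
  forall dl eta, 0 < dl -> 0 < eta -> chain dl (L + eta) x y.

Lemma limit_chain0 x : limit_chain 0 x x.
Proof. by move=> dl e dl0 e0; apply: chain_le (chain0 _ _) => //; lra. Qed.

Lemma limit_chain_mdist L x y : limit_chain L x y -> mdist x y <= L.
Proof.
move=> c; apply/ler_addgt0Pr => e e0.
exact: chain_mdist (c _ _ e0 e0).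
Qed.

Lemma limit_chain_ge0 L x y : limit_chain L x y -> 0 <= L.
Proof. by move=> /limit_chain_mdist; apply: le_trans; exact: mdist_ge0. Qed.

Lemma limit_chain_le L L' x y : L <= L' -> limit_chain L x y -> limit_chain L' x y.
Proof. by move=> LL c dl e d0 e0; apply: chain_le (c _ _ d0 e0) => //; lra. Qed.

Lemma limit_chain_trans y L L' x z :
  limit_chain L x y -> limit_chain L' y z -> limit_chain (L + L') x z.
Proof.
move=> c c' dl e d0 e0; have e20 : 0 < e / 2 by lra.
apply: chain_le (chain_trans (c _ _ d0 e20) (c' _ _ d0 e20)) => //; lra.
Qed.

Lemma limit_chain_sym L x y : limit_chain L x y -> limit_chain L y x.
Proof. by move=> c dl e d0 e0; apply: chain_sym; exact: c. Qed.

(** One short step at each end absorbs the moved endpoints. This is what lets [limit_chain] pass to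
    limits. *)
Lemma limit_chain_perturb L x y :
  (forall r, 0 < r -> exists x' y' L',
    [/\ mdist x x' < r, mdist y' y < r, L' < L + r & chain r L' x' y']) ->
  limit_chain L x y.
Proof.
move=> H dl e d0 e0.
(* The two end steps and the excess of [L'] over [L] each cost less than [r], hence a third of
   [e]. *)
pose r := Num.min dl (e / 3).
have r0 : 0 < r by rewrite lt_min d0/=; lra.
have rd : r <= dl by rewrite ge_min lexx.
have re : r <= e / 3 by rewrite ge_min lexx orbT.
have [x' [y' [L' [xx yy LL c]]]] := H _ r0.
apply: chain_le rd _ (chain_trans (chain1 xx) (chain_trans c (chain1 yy))).
lra.
Qed.

Lemma limit_chain_closed L x : closed [set y | limit_chain L x y].
Proof.
move=> y cy /=; apply: limit_chain_perturb => r r0.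
have [y' [/= cy']] := cy _ (nbhsx_ballx y r r0).
rewrite ballEmdist /= metric_sym => yr.
exists x, y', (L + r / 2); rewrite mdistxx; split => //; first by lra.
by apply: cy' => //; lra.
Qed.

(** The step function [tau] waits at each vertex for as long as the next step is long, then jumps.
    Between two times it covers at most the elapsed time plus one step, whence the extra [dl];
    started at time 0 it never runs ahead. *)
Lemma chain_parametrization dl L x y : 0 < dl -> chain dl L x y ->
  exists tau : R -> X, [/\ forall t, L <= t -> tau t = y,
    forall t, 0 <= t -> chain dl t x (tau t) &
    forall s t, 0 <= s <= t -> chain dl (t - s + dl) (tau s) (tau t)].
Proof.
move=> dl0 [p]; elim: p x L => [|a p IH] x L /= [].
  move=> _ <- _; exists (fun=> x); split => // [t t0|s t st].
    exact: chain_le (chain0 _ _).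
  apply: chain_le (chain0 _ _) => //; lra.
move=> /andP[xa pp] lp wp.
have [|tau [tauy taux taust]] := IH a (L - mdist x a); first by split => //; lra.
have d0 := mdist_ge0 x a.
exists (fun t => if t < mdist x a then x else tau (t - mdist x a)); split.
- move=> t Lt; have -> : (t < mdist x a) = false.
    apply/negbTE; rewrite -leNgt.
    by have := mdist_le_walk_length a p; have := mdist_ge0 a (last a p); lra.
  by apply: tauy; lra.
- move=> t t0; case: ltP => ta; first exact: chain_le (chain0 _ _).
  apply: chain_le (chain_trans (chain1 xa) (taux (t - mdist x a) _)) => //; lra.
- move=> s t /andP[s0 st]; case: ltP => sa; case: ltP => ta.
  + apply: chain_le (chain0 _ _) => //; lra.
  + apply: chain_le (chain_trans (chain1 xa) (taux (t - mdist x a) _)) => //; lra.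
  + lra.
  + apply: chain_le (taust (s - mdist x a) (t - mdist x a) _) => //; lra.
Qed.

Lemma compact_limit_chain_path L x y : compact [set: X] -> limit_chain L x y ->
  exists tau : R -> X, [/\ tau 0 = x, tau L = y &
    forall s t, 0 <= s <= t -> limit_chain (t - s) (tau s) (tau t)].
Proof.
move=> Xc xy.
have L0 := limit_chain_ge0 xy.
pose e (n : nat) : R := n.+1%:R^-1.
have e0 n : 0 < e n by rewrite invr_gt0.
have /choice[sigma sigmaP] n := chain_parametrization (e0 n) (xy _ _ (e0 n) (e0 n)).
(* Along an ultrafilter on the indices every cluster point is a limit, so by compactness [sigma n t]
   converges for all [t] at once. *)
have [G [UG GF]] := ultraFilterLemma (@eventually_filter).
have /choice[tau tauP] : forall t, exists z, (sigma ^~ t) @ G --> z.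
  move=> t; have [z [_ zP]] := Xc (sigma ^~ t @ G) _ filterT.
  exists z => U Uz; have [//|GU] := in_ultra_setVsetC (sigma ^~ t @^-1` U) UG.
  by have [w []] := zP (~` U) U GU Uz.
have near (s t r : R) : 0 < r -> exists n,
    [/\ e n < r, mdist (tau s) (sigma n s) < r & mdist (tau t) (sigma n t) < r].
  move=> r0; apply: (@filter_ex _ G); near=> n; split.
  - near: n; apply: GF; exact: near_infty_natSinv_lt (PosNum r0).
  - near: n; exact: (metricType_numDomainType.cvgrPdist_lt _ _).1 (tauP s) r r0.
  - near: n; exact: (metricType_numDomainType.cvgrPdist_lt _ _).1 (tauP t) r r0.
have dist0 z z' : (forall r : R, 0 < r -> mdist z z' < r) -> z = z'.
  move=> H; apply/mdist_positivity/eqP; rewrite eq_le mdist_ge0 andbT.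
  by apply/ler_addgt0Pr => r r0; rewrite add0r ltW// H.
exists tau; split.
- apply: dist0 => r r0; have [n [_ tn _]] := near 0 0 r r0.
  have [_ /(_ 0 (lexx _))/chain_mdist + _] := sigmaP n.
  have := metric_triangle (tau 0) (sigma n 0) x.
  by rewrite (metric_sym (sigma n 0)); lra.
(* The chain may have length [L + e n], so [sigma n] is only known to be at [y] from that time on;
   getting there from time [L] costs at most [2 * e n]. *)
- apply: dist0 => r r0; have [|n [en tn _]] := near L L (r / 3); first by lra.
  have [sy _ ss] := sigmaP n; have := e0 n.
  have := metric_triangle (tau L) (sigma n L) y.
  have /chain_mdist : chain (e n) (L + e n - L + e n) (sigma n L) (sigma n (L + e n)).
    by apply: ss; have := e0 n; lra.
  by rewrite (sy (L + e n))//; lra.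
- move=> s t st; apply: limit_chain_perturb => r r0.
  have [n [en sn tn]] := near s t r r0.
  have [_ _ /(_ _ _ st) c] := sigmaP n.
  exists (sigma n s), (sigma n t), (t - s + e n).
  rewrite (metric_sym _ (tau t)); split => //; first by lra.
  by apply: chain_le c => //; exact: ltW.
Unshelve. all: by end_near.
Qed.
End Chains.

(** * Covers of bounded total diameter and chains along them *)

Section Covers.
Variables (R : realType) (X : metricType R).
Implicit Types (x y z : X) (dl a M : R) (V : nat -> set X) (w : nat -> R).

Lemma sum_uniq_le_nneseries w (s : seq nat) : (forall k, 0 <= w k) -> uniq s ->
  ((\sum_(k <- s) w k)%:E <= \sum_(0 <= k <oo) (w k)%:E)%E.
Proof.
move=> w0 us; pose N := (\max_(k <- s) k.+1)%N.
have sN k : k \in s -> (k < N)%N.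
  by move=> ks; rewrite /N; exact: (leq_bigmax_seq (P := predT) (F := succn)).
apply: le_trans (nneseries_lim_ge (m := 0) (P := predT) N _); last first.
  by move=> k _ _; rewrite lee_fin.
rewrite sumEFin lee_fin (perm_big [seq k <- iota 0 N | k \in s]); last first.
  apply: uniq_perm => // [|k]; first exact/filter_uniq/iota_uniq.
  by rewrite mem_filter mem_iota/= add0n; case: (boolP (k \in s)) => // /sN ->.
rewrite big_filter /= /index_iota subn0 big_mkcond /=.
by apply: ler_sum => k _; case: ifP.
Qed.

Lemma hausdorff1_contentS dl dl' : dl <= dl' ->
  (hausdorff1_content X dl' <= hausdorff1_content X dl)%E.
Proof.
move=> dd; apply: le_ereal_inf_tmp => _ [U [UX Ud] <-]; apply: ereal_inf_lbound.
exists U => //; split => // i; by apply: lt_le_trans (Ud i) _; rewrite lee_fin.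
Qed.

(** Shrinking [dl] leaves fewer covers, so the content is monotone and its right limit at 0 is a
    supremum. *)
Lemma hausdorff1_content_le dl : 0 < dl ->
  (hausdorff1_content X dl <= hausdorff1 X)%E.
Proof.
move=> dl0; rewrite /hausdorff1.
have := @nonincreasing_at_right_cvge R (hausdorff1_content X) 0 (BInfty _ false) isT.
move=> /(_ _)/cvg_lim -> //.
  by apply: ereal_sup_ubound; exists dl => //=; rewrite in_itv /= dl0.
by move=> d d' _ _; exact: hausdorff1_contentS.
Qed.

(** Bounding duplicate-free finite sums lets disjoint families of indices be charged against [M]
    together. *)
Definition small_open_cover dl M V w :=
  [/\ forall k, open (V k), \bigcup_k V k = [set: X],
      forall k x y, V k x -> V k y -> mdist x y <= w k,
      forall k, 0 <= w k < dl &
      forall s, uniq s -> \sum_(k <- s) w k <= M].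

Lemma mdist_le_diam (U : set X) x y : U x -> U y -> ((mdist x y)%:E <= diam U)%E.
Proof. by move=> Ux Uy; apply: ereal_sup_ubound; right; exists (x, y). Qed.

Lemma diam_ge0 (U : set X) : (0 <= diam U)%E.
Proof. by apply: ereal_sup_ubound; left. Qed.

Lemma open_metric_ball x (r : R) : open (ball x r).
Proof.
rewrite openE => y; rewrite ballEmdist /= => xy.
have r0 : 0 < r - mdist x y by lra.
rewrite /interior; apply: filterS (nbhsx_ballx y _ r0) => z.
by rewrite !ballEmdist /= => yz; have := metric_triangle x y z; lra.
Qed.

Lemma finite_hausdorff1_cover : (hausdorff1 X < +oo)%E ->
  exists M, forall dl, 0 < dl -> exists V w, small_open_cover dl M V w.
Proof.
(* One unit pays for missing the infimum, the other for enlarging the sets to open ones. *)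
move=> fin; exists (fine (hausdorff1 X) + 2) => dl dl0.
have H0 : (0 <= hausdorff1 X)%E.
  apply: le_trans (hausdorff1_content_le dl0).
  apply: le_ereal_inf_tmp => _ [U _ <-].
  by apply: nneseries_ge0 => *; exact: diam_ge0.
have Hfin : hausdorff1 X \is a fin_num by rewrite ge0_fin_numE.
have dl20 : 0 < dl / 2 by lra.
have [|_ [U [UX Ud] <-] sumU] := @ereal_inf_lt R
    [set (\sum_(0 <= i <oo) diam (U i))%E | U in
    [set U : nat -> set X | \bigcup_i U i = [set: X] /\
                            forall i, (diam (U i) < (dl / 2)%:E)%E]] (hausdorff1 X + 1)%E.
  apply: le_lt_trans (hausdorff1_content_le dl20) _.
  by rewrite -(fineK Hfin) -EFinD lte_fin; lra.
have Ufin i : diam (U i) \is a fin_num.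
  by rewrite ge0_fin_numE ?diam_ge0// (lt_trans (Ud i))// ltry.
pose c := Num.min 1 (dl / 2).
have c0 : 0 < c by rewrite lt_min ltr01.
have c1 : c <= 1 by rewrite ge_min lexx.
have cd : c <= dl / 2 by rewrite ge_min lexx orbT.
(* Geometric weights of sum [c]: enlarging [U k] by balls of radius [e k / 2] adds at most [e k] to
   its diameter, which is at most [dl / 2] for each set and at most 1 in total. *)
pose e k : R := c / (2 ^ k.+1)%:R.
have e0 k : 0 < e k by rewrite divr_gt0// ltr0n expn_gt0.
have ec k : e k <= c.
  by rewrite ler_pdivrMr ?ltr0n ?expn_gt0// ler_peMr ?(ltW c0)// ler1n expn_gt0.
pose w k := fine (diam (U k)) + e k.
have w0 k : 0 <= w k by rewrite addr_ge0 ?fine_ge0 ?diam_ge0// ltW.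
exists (fun k => \bigcup_(x in U k) ball x (e k / 2))%classic, w; split.
- by move=> k; apply: bigcup_open => x _; exact: open_metric_ball.
- apply/seteqP; split => // x _; have : (\bigcup_i U i) x by rewrite UX.
  move=> [k _ Ux]; exists k => //; exists x => //.
  by apply: ballxx; rewrite divr_gt0.
- move=> k x y [x' Ux' +] [y' Uy']; rewrite !ballEmdist /= => xx yy.
  have : mdist x' y' <= fine (diam (U k)).
    by rewrite -lee_fin fineK// mdist_le_diam.
  have := metric_triangle x x' y; have := metric_triangle x' y' y.
  by rewrite (metric_sym x x') /w; lra.
- move=> k; rewrite w0 /=.
  have : fine (diam (U k)) < dl / 2 by rewrite -lte_fin fineK.
  by have := ec k; rewrite /w; lra.
- move=> s us; rewrite -lee_fin.
  apply: le_trans (sum_uniq_le_nneseries w0 us) _.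
  under eq_eseriesr do rewrite /w EFinD fineK//.
  apply: le_trans (epsilon_trick xpredT _ _) _.
  + by move=> n; exact: diam_ge0.
  + exact: ltW.
  + rewrite EFinD fineK//.
    have -> : 2%:E = (1%:E + 1%:E)%E :> \bar R by rewrite -EFinD.
    rewrite addeA; apply: leeD; first exact: ltW.
    by rewrite lee_fin.
Qed.

Variables (dl M : R) (V : nat -> set X) (w : nat -> R).
Hypotheses (Xc : connected [set: X]) (dl0 : 0 < dl).
Hypothesis (VP : small_open_cover dl M V w).

(** The members reachable from [i] have an open union, and so do the others; no other member meets a
    reachable one. By connectedness the first union is everything. *)
Lemma connected_cover_path i x y : V i x ->
  exists2 s, path (fun i j => `[< V i `&` V j !=set0 >]) i s & V (last i s) y.
Proof.
have [Vo VX _ _ _] := VP.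
move=> Vx; pose e i j := `[< V i `&` V j !=set0 >].
pose I := [set j | exists2 s, path e i s & last i s = j].
suff : \bigcup_(j in I) V j = [set: X].
  move=> UX; have : (\bigcup_(j in I) V j) y by rewrite UX.
  by move=> [j [s ps <-] Vy]; exists s.
apply: Xc.
- by exists x, i => //; exists [::].
- by exists (\bigcup_(j in I) V j); rewrite ?setTI//; apply: bigcup_open => *.
- exists (\bigcup_(j in I) V j); rewrite ?setTI//.
  rewrite -openC (_ : ~` _ = \bigcup_(j in ~` I) V j).
    by apply: bigcup_open => *.
  apply/seteqP; split => [z zI|z [j jI Vz] [k [s ps ls] Vkz]].
    have : (\bigcup_j V j) z by rewrite VX.
    by move=> [j _ Vz]; exists j => // jI; apply: zI; exists j.
  apply: jI; exists (rcons s j); rewrite ?last_rcons// rcons_path ps ls.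
  by apply/asboolP; exists z.
Qed.

(** Walk through points of consecutive intersections, crossing [V i] at cost at most [w i]. If the
    budget [a] runs out before [y], the members met so far form [t]. *)
Lemma path_chain_or_exit s i x y a : 0 < a -> V i x ->
  path (fun i j => `[< V i `&` V j !=set0 >]) i s -> V (last i s) y ->
  chain dl a x y \/
  exists t, [/\ subseq t (i :: s), a <= \sum_(k <- t) w k &
    forall k, k \in t -> exists2 z, V k z & chain dl a x z].
Proof.
have [_ _ Vw wdl _] := VP.
elim: s i x a => [|j s IH] i x a a0 Vx /=.
  move=> _ Vy; have := Vw _ _ _ Vx Vy => xy; have [aw|wa] := leP a (w i).
    right; exists [:: i]; rewrite eqxx big_seq1; split => // k.
    rewrite inE => /eqP ->; exists x => //.
    by apply: chain_le (chain0 _ _) => //; exact: ltW.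
  left; apply: chain_le (chain1 (dl := dl) _) => //; first by rewrite (le_trans xy) ?ltW.
  by rewrite (le_lt_trans xy)//; have /andP[] := wdl i.
move=> /andP[/asboolP[z [Vz Vjz]] ps] Vy.
have xz := Vw _ _ _ Vx Vz; have /andP[w0 wd] := wdl i.
have cxz : chain dl (w i) x z.
  by apply: chain_le (chain1 (dl := dl) _) => //; exact: le_lt_trans wd.
have [aw|wa] := leP a (w i).
  right; exists [:: i]; split; [by rewrite /= eqxx | by rewrite big_seq1 | ].
  move=> k; rewrite inE => /eqP ->; exists x => //.
  by apply: chain_le (chain0 _ _) => //; exact: ltW.
have [|cy|[t [st ta tc]]] := IH j z (a - w i) _ Vjz ps Vy; first by lra.
  by left; apply: chain_le (chain_trans cxz cy) => //; lra.
right; exists (i :: t); split; [by rewrite /= eqxx | by rewrite big_cons; lra | ].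
move=> k; rewrite inE => /predU1P[->|/tc [z' Vz' cz']].
  by exists x => //; apply: chain_le (chain0 _ _) => //; exact: ltW.
by exists z' => //; apply: chain_le (chain_trans cxz cz') => //; lra.
Qed.

Lemma chain_or_exit x y a : 0 < a -> chain dl a x y \/
  exists t, [/\ uniq t, a <= \sum_(k <- t) w k &
    forall k, k \in t -> exists2 z, V k z & chain dl a x z].
Proof.
have [_ VX _ _ _] := VP => a0.
have : (\bigcup_j V j) x by rewrite VX.
move=> [i _ Vx]; have [s ps] := connected_cover_path y Vx.
(* Removing repetitions from the sequence makes [t] duplicate-free, so that [M] bounds its
   weight. *)
case/shortenP: ps => s' ps' us' _ Vy.
have [|[t [st ta tc]]] := path_chain_or_exit a0 Vx ps' Vy; first by left.
by right; exists t; split => //; exact: subseq_uniq us'.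
Qed.

(** An exit with budget [M + 1] would need distinct members of total weight above [M]. *)
Lemma chain_cover_bound x y : chain dl (M + 1) x y.
Proof.
have [_ _ _ _ wM] := VP.
have M0 : 0 <= M by have := wM [::] isT; rewrite big_nil.
have [|//|[t [ut]]] := @chain_or_exit x y (M + 1); first by lra.
by have := wM t ut; lra.
Qed.

(** The extra point [x0] is a common target that no point of [s] reaches with budget [a], so each of
    them has an exit family of weight at least [a]. A member common to two families would join their
    points at cost [3 * a]: two approaches and one crossing, the latter below [dl]. *)
Lemma separated_size_bound (s : seq X) a x0 : dl <= a ->
  pairwise (fun x y => `[< ~ chain dl (3 * a) x y >]) (x0 :: s) ->
  (size s)%:R * a <= M.
Proof.
have [_ _ Vw wdl wM] := VP.
move=> dla; have a0 : 0 < a by exact: lt_le_trans dla.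
rewrite pairwise_cons => /andP[x0s sep].
suff [t [ut ta _]] : exists t, [/\ uniq t, (size s)%:R * a <= \sum_(k <- t) w k &
    forall k, k \in t -> exists x, x \in s /\ exists2 z, V k z & chain dl a x z].
  exact: le_trans (wM _ ut).
elim: s x0s sep => [|x s IH] /=.
  by move=> _ _; exists [::]; rewrite mul0r big_nil.
move=> /andP[/asboolP x0x x0s] /andP[xs sep].
have [t [ut ta tc]] := IH x0s sep.
have [c|[t' [ut' ta' tc']]] := chain_or_exit x x0 a0.
  case: x0x; apply: chain_sym; apply: chain_le c => //; lra.
exists (t' ++ t); split.
- rewrite cat_uniq ut' ut andbT; apply/hasPn => k kt; apply/negP => kt'.
  have [z Vz cz] := tc' k kt'; have [x' [x's [z' Vz' cz']]] := tc k kt.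
  have /allP/(_ _ x's)/asboolP := xs; apply.
  have zz' := Vw _ _ _ Vz Vz'; have /andP[_ wk] := wdl k.
  have czz' : chain dl a z z'.
    by apply: chain_le (chain1 (le_lt_trans zz' wk)) => //; lra.
  apply: chain_le (chain_trans cz (chain_trans czz' (chain_sym cz'))) => //; lra.
- by rewrite big_cat /= mulrSr; lra.
- move=> k; rewrite mem_cat => /orP[/tc' h|/tc [x' [x's h]]].
    by exists x; rewrite mem_head.
  by exists x'; rewrite inE x's orbT.
Qed.

End Covers.

(** * Arc length compared with chain length *)

Section ArcLength.
Variables (R : realType) (X : metricType R).
Implicit Types (sigma : R -> X) (s : seq R) (L : R).

Lemma sum_mdist_walk_length sigma a s :
  \sum_(0 <= i < size s)
    mdist (sigma (nth 1 (a :: s) i)) (sigma (nth 1 (a :: s) i.+1)) =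
  walk_length (sigma a) (map sigma s).
Proof.
elim: s a => [|b s IH] a /=; first by rewrite big_nil.
by rewrite big_nat_recl//= -IH.
Qed.

Lemma lipschitz_arc_length sigma L :
  (forall t u, 0 <= t -> t <= u -> u <= 1 -> mdist (sigma t) (sigma u) <= L * (u - t)) ->
  (arc_length sigma <= L%:E)%E.
Proof.
move=> lip; apply: ge_ereal_sup => _ [s s01 <-]; rewrite lee_fin.
rewrite /polygonal_length sum_mdist_walk_length.
suff H a : 0 <= a -> itv_partition a 1 s ->
    walk_length (sigma a) (map sigma s) <= L * (1 - a).
  by rewrite (le_trans (H 0 (lexx _) s01))// subr0 mulr1.
elim: s a {s01} => [|b s IH] a a0.
  by move=> /itv_partition_nil ->; rewrite subrr mulr0.
move=> abs; have bs := itv_partition_cons abs; have b1 := itv_partition_le bs.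
case: abs => /= /andP[ab _] _.
have := IH b (le_trans a0 (ltW ab)) bs; have := lip a b a0 (ltW ab) b1.
by move=> h1 h2; apply: le_trans (lerD h1 h2) _; rewrite -mulrDr addrC addrA subrK.
Qed.

Lemma within_continuous_mdistP (A : set R) sigma :
  {within A, continuous sigma} <-> forall t, A t -> forall e, 0 < e ->
    exists2 d, 0 < d & forall u, A u -> `|t - u| < d -> mdist (sigma t) (sigma u) < e.
Proof.
rewrite subspace_continuousP; split => sc t At.
  move=> e e0; have FF : Filter (within A (nbhs t)) by exact: within_filter.
  have := (metricType_numDomainType.cvgrPdist_lt (FF := FF) _ _).1 (sc t At) e e0.
  rewrite near_withinE => /nbhs_normP[d /= d0 dP]; exists d => // u Au tu; exact: dP.
have FF : Filter (within A (nbhs t)) by exact: within_filter.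
apply/metricType_numDomainType.cvgrPdist_lt => e e0.
by have [d d0 dP] := sc t At e e0; apply/nbhs_normP; exists d => // u tu Au; exact: dP.
Qed.

Lemma continuous_segment_fine_partition sigma dl : 0 < dl ->
  {within `[0, 1], continuous sigma} ->
  exists2 s, itv_partition 0 1 s &
    path (fun x y => mdist x y < dl) (sigma 0) (map sigma s).
Proof.
move=> dl0 /within_continuous_mdistP sc.
pose P d (t : R) := forall u, `[0, 1]%classic t -> `[0, 1]%classic u ->
  `|t - u| < d -> mdist (sigma t) (sigma u) < dl.
(* Uniform continuity, from the near-covering form of compactness of the segment. *)
have [d d0 dP] : exists2 d : R, 0 < d & `[0, 1]%classic `<=` P d.
  have := @segment_compact R 0 1; rewrite compact_near_coveringP.
  move=> /(_ R 0^'+ P _) H.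
  have {}H : \forall d \near 0^'+, `[0, 1]%classic `<=` P d.
    apply: H => t t01.
    have dl20 : 0 < dl / 2 by lra.
    have [e e0 eP] := sc t t01 _ dl20.
    exists (ball t (e / 2), [set d | 0 < d < e / 2]).
      split => /=; first by apply: nbhsx_ballx; lra.
      near=> d; apply/andP; split; near: d; first exact: nbhs_right_gt.
      by apply: nbhs_right_lt; lra.
    move=> [t' d] /= [tt' /andP[d0 de]] u t'01 u01 t'u.
    have tt'e : `|t - t'| < e / 2 by [].
    have h1 : mdist (sigma t) (sigma t') < dl / 2.
      by apply: eP => //; lra.
    have h2 : mdist (sigma t) (sigma u) < dl / 2.
      by apply: eP => //; have := ler_distD t' t u; lra.
    have := metric_triangle (sigma t') (sigma t) (sigma u).
    by rewrite (metric_sym (sigma t') (sigma t)); lra.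
  have /filter_ex[d [d0 dP]] : \forall d \near 0^'+, 0 < d /\ `[0, 1]%classic `<=` P d.
    by apply: filterI => //; exact: nbhs_right_gt.
  by exists d.
pose N := Num.truncn d^-1; pose h : R := N.+1%:R^-1.
have h0 : 0 < h by rewrite invr_gt0.
have hd : h < d by rewrite invf_plt ?posrE// truncnS_gt.
(* [n] counts the remaining steps of length [h]; the equation makes the partition end exactly at
   1. *)
suff H n a : 0 <= a -> a + n%:R * h = 1 -> exists2 s, itv_partition a 1 s &
    path (fun x y => mdist x y < dl) (sigma a) (map sigma s).
  by apply: (H N.+1); rewrite // add0r mulfV.
elim: n a => [|n IH] a a0.
  by rewrite mul0r addr0 => <-; exists [::].
rewrite mulrSr mulrDl mul1r => an1.
have nh0 : 0 <= n%:R * h by rewrite mulr_ge0// ltW.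
have [||s s1 ps] := IH (a + h); [by lra | by lra | ].
exists (a + h :: s).
  by case: s1 => p l; split => //=; rewrite ltrDl h0.
rewrite /= ps andbT; apply: dP => //=; rewrite ?in_itv/=; first by apply/andP; split; lra.
- by apply/andP; split; lra.
- by apply/andP; split; lra.
- by rewrite opprD addrA subrr sub0r normrN gtr0_norm.
Unshelve. all: by end_near.
Qed.

Lemma arc_length_limit_chain sigma L : {within `[0, 1], continuous sigma} ->
  (arc_length sigma <= L%:E)%E -> limit_chain L (sigma 0) (sigma 1).
Proof.
move=> sc sL dl eta dl0 eta0.
have [s s01 ps] := continuous_segment_fine_partition dl0 sc.
exists (map sigma s); split => //.
  by rewrite last_map; case: s01 => _ /eqP ->.
apply: le_trans (_ : L <= _); last by rewrite lerDl ltW.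
rewrite -sum_mdist_walk_length -lee_fin.
by apply: le_trans sL; apply: ereal_sup_ubound; exists s.
Qed.
End ArcLength.

(** * The metric given by limit chains, identified with the intrinsic metric *)

Section IntrinsicMetric.
Variables (R : realType) (X : metricType R) (M : R).
Implicit Types (x y z : X) (dl L a : R).
Hypotheses (Xcompact : compact [set: X]) (Xconn : connected [set: X]).
Hypothesis covers :
  forall dl, 0 < dl -> exists V w, @small_open_cover R X dl M V w.

Lemma limit_chain_cover_bound x y : limit_chain (M + 1) x y.
Proof.
move=> dl eta dl0 eta0; have [V [w VP]] := covers dl0.
by apply: chain_le (chain_cover_bound Xconn VP x y) => //; lra.
Qed.

(** For each listed point chains fail at some scale, hence at all finer ones; a finite list has a
    common scale, at which a cover can then be used. *)
Lemma not_limit_chain_scale (s : seq X) L y :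
  (forall x, x \in s -> ~ limit_chain L y x) ->
  exists2 dl, 0 < dl & forall dl', dl' <= dl -> forall x, x \in s -> ~ chain dl' L y x.
Proof.
elim: s => [_|x s IH sL]; first by exists 1.
have [|dl dl0 dlP] := IH; first by move=> z zs; apply: sL; rewrite inE zs orbT.
have [d [e [d0 e0 ne]]] : exists d e, [/\ 0 < d, 0 < e & ~ chain d (L + e) y x].
  apply: contrapT => H; apply: (sL x (mem_head _ _)) => d e d0 e0.
  by apply: contrapT => ne; apply: H; exists d, e.
exists (Num.min d dl); first by rewrite lt_min d0.
move=> dl'; rewrite le_min => /andP[dd dldl] z; rewrite inE => /predU1P[->|zs].
  by move=> c; apply: ne; apply: chain_le c => //; lra.
exact: dlP zs.
Qed.

(** Otherwise points can be picked greedily, each far from the previous ones, beyond the number that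
    [separated_size_bound] allows. *)
Lemma limit_chain_totally_bounded a : 0 < a ->
  exists s : seq X, forall y, exists2 x, x \in s & limit_chain (3 * a) y x.
Proof.
move=> a0; apply: contrapT => H.
have {}H (s : seq X) : exists y, forall x, x \in s -> ~ limit_chain (3 * a) y x.
  apply: contrapT => H'; apply: H; exists s => y; apply: contrapT => H.
  by apply: H'; exists y => x xs xL; apply: H; exists x.
have sep N : exists s dl, [/\ size s = N, 0 < dl & forall dl', dl' <= dl ->
    pairwise (fun x y : X => `[< ~ chain dl' (3 * a) x y >]) s].
  elim: N => [|N [s [dl [sN dl0 sP]]]]; first by exists [::], 1.
  have [y yP] := H s; have [d d0 dP] := not_limit_chain_scale yP.
  exists (y :: s), (Num.min d dl); rewrite /= sN; split => //.
    by rewrite lt_min d0.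
  move=> dl'; rewrite le_min => /andP[dd dldl]; rewrite sP// andbT.
  by apply/allP => x xs; apply/asboolP; exact: dP.
(* One point serves as [x0]; the number of the others still exceeds [M / a]. *)
have [s [dl [sN dl0 sP]]] := sep (Num.truncn (M / a)).+2.
case: s sN sP => [//|x0 s] /= [sN] sP.
have d0 : 0 < Num.min dl a by rewrite lt_min dl0.
have [V [w VP]] := covers d0.
have mina : Num.min dl a <= a by rewrite ge_min lexx orbT.
have mindl : Num.min dl a <= dl by rewrite ge_min lexx.
have := separated_size_bound Xconn d0 VP mina (sP _ mindl).
by rewrite sN -ler_pdivlMr// leNgt truncnS_gt.
Qed.

(** Finitely many limit-chain balls of radius [a / 2] cover the space, and they are closed for
    [mdist]. Points near [x] avoid those that miss [x], so they share a ball with [x]. *)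
Lemma limit_chain_near x a : 0 < a -> \forall y \near x, limit_chain a x y.
Proof.
move=> a0; have a60 : 0 < a / 6 by lra.
have [s sP] := limit_chain_totally_bounded a60; set L := 3 * _ in sP.
have H : \forall y \near x, forall z, z \in s -> limit_chain L z y -> limit_chain L z x.
  elim: s {sP} => [|z s IH]; first by apply: nearW.
  have nz : \forall y \near x, limit_chain L z y -> limit_chain L z x.
    have [c|c] := pselect (limit_chain L z x); first exact: nearW.
    have := closed_openC (@limit_chain_closed _ _ L z).
    rewrite openE => /(_ x c); by apply: filterS => y ny cy; case: (ny cy).
  apply: filterS2 nz IH => y h1 h2 u; rewrite inE => /predU1P[->|]//; exact: h2.
apply: filterS H => y yP; have [z zs cz] := sP y.
have zx := yP z zs (limit_chain_sym cz).
apply: limit_chain_le (limit_chain_sym (limit_chain_trans cz zx)).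
rewrite /L; lra.
Qed.

Definition rho x y : R := inf [set L | limit_chain L x y].

Lemma rho_le L x y : limit_chain L x y -> rho x y <= L.
Proof.
move=> c; apply: ge_inf => //; exists 0 => L'; exact: limit_chain_ge0.
Qed.

(** The infimum is attained because [limit_chain] already allows any positive excess; the cover
    bound makes the set of lengths nonempty. *)
Lemma limit_chain_rho x y : limit_chain (rho x y) x y.
Proof.
move=> dl eta dl0 eta0; have e20 : 0 < eta / 2 by lra.
have hi : has_inf [set L | limit_chain L x y].
  split; first by exists (M + 1); exact: limit_chain_cover_bound.
  by exists 0 => L'; exact: limit_chain_ge0.
have [L cL Ll] := inf_adherent e20 hi.
apply: chain_le (cL _ _ dl0 e20) => //; rewrite -/(rho x y) in Ll; lra.
Qed.

Lemma rho_ge0 x y : 0 <= rho x y.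
Proof. exact: limit_chain_ge0 (@limit_chain_rho x y). Qed.

Lemma mdist_le_rho x y : mdist x y <= rho x y.
Proof. exact: limit_chain_mdist (@limit_chain_rho x y). Qed.

Lemma rhoxx x : rho x x = 0.
Proof. by apply/eqP; rewrite eq_le rho_ge0 andbT rho_le//; exact: limit_chain0. Qed.

Lemma rho_sym x y : rho x y = rho y x.
Proof.
by apply/eqP; rewrite eq_le !rho_le//; apply: limit_chain_sym; exact: limit_chain_rho.
Qed.

Lemma rho_triangle y x z : rho x z <= rho x y + rho y z.
Proof. by apply: rho_le; apply: limit_chain_trans; exact: limit_chain_rho. Qed.

Lemma rho_is_metric : is_metric rho.
Proof.
split; [exact: rho_ge0 | | exact: rho_sym | by move=> *; exact: rho_triangle].
move=> x y; split => [xy|->]; last exact: rhoxx.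
apply: mdist_positivity; apply/eqP.
by rewrite eq_le mdist_ge0 -[leRHS]xy mdist_le_rho.
Qed.

Lemma rho_induces_topology : induces_topology rho.
Proof.
move=> U; split => [Uo x Ux|UP].
  have /nbhs_ballP[e /= e0 eU] : nbhs x U by exact: open_nbhs_nbhs.
  exists e => // y /= xy; apply: eU; rewrite ballEmdist /=.
  exact: le_lt_trans (mdist_le_rho _ _) xy.
rewrite openE => x /UP[e e0 eU]; have e20 : 0 < e / 2 by lra.
rewrite /interior; apply: filterS (limit_chain_near x e20) => y c.
by apply: eU => /=; have := rho_le c; lra.
Qed.

(** The path bounds [rho] from above on the three pieces cut off by [s] and [t]. These bounds add up
    to [rho x y], so by the triangle inequality none is strict. *)
Lemma rho_geodesic_path x y : exists tau : R -> X,
  [/\ tau 0 = x, tau (rho x y) = y &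
    forall s t, 0 <= s -> s <= t -> t <= rho x y -> rho (tau s) (tau t) = t - s].
Proof.
have [tau [t0 tL tP]] := compact_limit_chain_path Xcompact (@limit_chain_rho x y).
exists tau; split => // s t s0 st tL'.
have h1 : rho (tau s) (tau t) <= t - s by apply/rho_le/tP; rewrite s0.
have h2 : rho x (tau s) <= s - 0 by apply: rho_le; rewrite -t0; apply: tP; rewrite lexx.
have h3 : rho (tau t) y <= rho x y - t.
  by apply: rho_le; rewrite -[y in limit_chain _ _ y]tL; apply: tP; rewrite tL' (le_trans s0).
have := rho_triangle (tau s) x y; have := rho_triangle (tau t) (tau s) y.
by move=> h4 h5; apply/eqP; rewrite eq_le h1 /=; lra.
Qed.

Lemma rho_geodesic : geodesic rho.
Proof.
move=> x y; have [tau [t0 tL tP]] := rho_geodesic_path x y.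
exists (rho x y), tau; split => // [|s t]; first exact: rho_ge0.
rewrite !in_itv /= => /andP[s0 sL] /andP[t0' tL'].
have [st|/ltW ts] := leP s t.
  by rewrite tP// ler0_norm ?opprB// subr_le0.
by rewrite rho_sym tP// ger0_norm// subr_ge0.
Qed.

Lemma rho_continuous x : continuous (rho x : X -> R).
Proof.
move=> z; apply/cvgrPdist_lt => e e0; have e20 : 0 < e / 2 by lra.
near=> u; have : limit_chain (e / 2) z u by near: u; exact: limit_chain_near.
move=> /rho_le zu; have := rho_triangle z x u; have := rho_triangle u x z.
by rewrite (rho_sym u z) ltr_norml => *; apply/andP; split; lra.
Unshelve. all: by end_near.
Qed.

(** Rescale a geodesic to [[0, 1]]: the continuous map [rho x] divided by [L] recovers the
    parameter, and [mdist <= rho] makes the arc [L]-Lipschitz, which bounds its length. *)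
Lemma geodesic_arc x y : x != y -> exists (A : set X) (sigma : R -> X),
  [/\ homeomorphism `[0 : R, 1]%classic A sigma, sigma 0 = x, sigma 1 = y &
    (arc_length sigma <= (rho x y)%:E)%E].
Proof.
move=> xy; have [tau [t0 tL tP]] := rho_geodesic_path x y.
have L0 : 0 < rho x y by apply: lt_le_trans (mdist_le_rho x y); rewrite mdist_gt0.
set L := rho x y in tL tP L0 *.
pose sigma t := tau (L * t).
have sP t u : 0 <= t -> t <= u -> u <= 1 -> rho (sigma t) (sigma u) = L * (u - t).
  move=> t0' tu u1; rewrite tP ?mulrBr//.
  - by rewrite mulr_ge0// ltW.
  - by rewrite ler_pM2l.
  - by rewrite -[leRHS]mulr1 ler_pM2l.
have lip t u : 0 <= t -> t <= u -> u <= 1 -> mdist (sigma t) (sigma u) <= L * (u - t).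
  by move=> *; rewrite -sP//; exact: mdist_le_rho.
have s0 : sigma 0 = x by rewrite /sigma mulr0.
have can t : `[0, 1]%classic t -> rho x (sigma t) / L = t.
  rewrite /= in_itv /= => /andP[t0' t1].
  by rewrite -s0 sP// subr0 mulrC mulKf// gt_eqF.
exists (sigma @` `[0, 1]%classic), sigma; split => //.
- split.
  + split => [t t01|t u|//]; first by exists t.
    by rewrite !inE => /can {2}<- /can {2}<- ->.
  + apply/within_continuous_mdistP => t t01 e e0.
    exists (e / L); first by rewrite divr_gt0.
    move: t01; rewrite /= in_itv /= => /andP[t0' t1] u.
    rewrite /= in_itv /= => /andP[u0 u1]; rewrite ltr_pdivlMr// mulrC.
    apply: le_lt_trans; have [tu|/ltW ut] := leP t u.
      by rewrite ler0_norm ?opprB ?lip// subr_le0.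
    by rewrite metric_sym ger0_norm ?lip// subr_ge0.
  + exists (fun z => rho x z / L).
      by move=> t; rewrite inE => /can.
    apply: continuous_subspaceT => z; apply: cvgMl; exact: rho_continuous.
- by rewrite /sigma mulr1.
- exact: lipschitz_arc_length.
Qed.

(** Geodesic arcs give one inequality. For the other, an arc of finite length yields a limit chain
    of that length between its ends. *)
Lemma intrinsic_edistE x y : intrinsic_edist x y = (rho x y)%:E.
Proof.
rewrite /intrinsic_edist; case: eqVneq => [->|xy]; first by rewrite rhoxx.
apply/eqP; rewrite eq_le; apply/andP; split.
  have [A [sigma [sA s0 s1 sl]]] := geodesic_arc xy.
  by apply: le_trans sl; apply: ereal_inf_lbound; exists A, sigma.
apply: le_ereal_inf_tmp => _ [A [sigma [[_ sc _] <- <- ->]]].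
case El : (arc_length sigma) => [l| |].
- by rewrite lee_fin; apply: rho_le; apply: arc_length_limit_chain => //; rewrite El.
- by rewrite leey.
(* The value [-oo] is excluded by the polygonal length of any one partition. *)
- have [s s01 _] := continuous_segment_fine_partition ltr01 sc.
  have : ((polygonal_length sigma s)%:E <= arc_length sigma)%E.
    by apply: ereal_sup_ubound; exists s.
  by rewrite El.
Qed.

End IntrinsicMetric.

Theorem corollary1p3 (R : realType) (X : metricType R)
    (Xcontinuum : continuum X)
    (Xgraph : graph_like R X)
    (Xfin : (hausdorff1 X < +oo)%E) :
  [/\ forall x y : X, intrinsic_edist x y \is a fin_num,
      is_metric (@intrinsic_dist R X),
      induces_topology (@intrinsic_dist R X) &
      geodesic (@intrinsic_dist R X)].
Proof.
have [Xc Xconn _] := Xcontinuum.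
have [M covers] := finite_hausdorff1_cover Xfin.
have edistE := intrinsic_edistE Xc Xconn covers.
have -> : @intrinsic_dist R X = @rho R X.
  by apply/funext => x; apply/funext => y; rewrite /intrinsic_dist edistE.
split.
- by move=> x y; rewrite edistE.
- exact: rho_is_metric covers.
- exact: rho_induces_topology covers.
- exact: rho_geodesic covers.
Qed.
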